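(* Let $X$ be a set, let $m,n\ge 2$ be integers, and let $f,g\in\Omega_m(X)$. Then $(X,f)$ is conjugate to $(X,g)$ if and only if $(\Omega_n(X),\odot_f)$ is conjugate to $(\Omega_n(X),\odot_g)$. Moreover, for $\pi\in\mathcal{S}_{m+1}$, if $g=f^\pi$ then $\odot_g=(\odot_f)^\pi$, and reciprocally (if $\odot_g=(\odot_f)^\pi$ then $g=f^\pi$).
   Context: For a set $Y$, $\Omega_m(Y)$ is the set of all $m$-ary operations $Y^m\to Y$. For $f\in\Omega_m(X)$, the $m$-ary operation $\odot_f$ on the set $\Omega_n(X)$ is defined by $\odot_f(h_1,\ldots,h_m)(\overline a):=f(h_1(\overline a),\ldots,h_m(\overline a))$ for all $h_1,\ldots,h_m\in\Omega_n(X)$ and $\overline a\in X^n$. $\mathcal{S}_{m+1}$ is the symmetric group on $\{1,\ldots,m+1\}$. For $F,G\in\Omega_m(Y)$ and $\pi\in\mathcal{S}_{m+1}$, one says that $(Y,G)$ is the $\pi$-conjugate of $(Y,F)$, written $G=F^\pi$, if for all $a_1,\ldots,a_{m+1}\in Y$, \[G(a_{\pi(1)},\ldots,a_{\pi(m)})=a_{\pi(m+1)}\iff F(a_1,\ldots,a_m)=a_{m+1}.\] $(Y,F)$ is conjugate to $(Y,G)$ if $G=F^\pi$ for some $\pi\in\mathcal{S}_{m+1}$. *)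

(* Defs.v *)
From mathcomp Require Import all_boot all_fingroup.

Set Implicit Arguments.
Unset Strict Implicit.
Unset Printing Implicit Defensive.

Definition Omega (m : nat) (Y : Type) : Type := m.-tuple Y -> Y.

Definition odot (m n : nat) (X : Type) (f : Omega m X) : Omega m (Omega n X) :=
  fun (h : m.-tuple (Omega n X)) (a : n.-tuple X) =>
    f [tuple tnth h i a | i < m].
Arguments odot {m} n {X} f h a.

(* The indices 1, ..., m+1 are the elements 0, ..., m of 'I_m.+1, so that
   widen_ord (leqnSn m) embeds 1, ..., m and ord_max stands for m+1.
   is_pi_conjugate pi F G reads G = F^pi; it is a relation because F^pi need
   not exist as an operation. *)
Definition is_pi_conjugate (m : nat) (Y : Type) (pi : 'S_m.+1)
    (F G : Omega m Y) : Prop :=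
  forall a : m.+1.-tuple Y,
    G [tuple tnth a (pi (widen_ord (leqnSn m) i)) | i < m]
      = tnth a (pi ord_max)
    <-> F [tuple tnth a (widen_ord (leqnSn m) i) | i < m] = tnth a ord_max.

Definition op_conjugate (m : nat) (Y : Type) (F G : Omega m Y) : Prop :=
  exists pi : 'S_m.+1, is_pi_conjugate pi F G.

(* Main.v *)
(* The operation [odot n f] acts on Omega n X = X^(X^n) coordinatewise, so by
   function extensionality its graph consists of the tuples all of whose
   evaluations at points of X^n lie in the graph of f. Conversely, restricted
   to constant functions, it is a copy of f. *)
Require Import Defs.
From mathcomp Require Import all_boot all_fingroup.
From Stdlib Require Import FunctionalExtensionality.

(** The selection [s] is left arbitrary to cover both sides of the conjugacy condition: [widen_ord]
    for [f], its composite with [pi] for [g]. *)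
Lemma odot_eval (X : Type) (m n k : nat) (f : Omega m X) (s : 'I_m -> 'I_k)
    (h : k.-tuple (Omega n X)) (x : n.-tuple X) :
  odot n f [tuple tnth h (s i) | i < m] x
  = f [tuple tnth [tuple tnth h j x | j < k] (s i) | i < m].
Proof.
by rewrite /odot; congr f; apply: eq_from_tnth => i; rewrite !tnth_mktuple.
Qed.

Lemma odot_const (X : Type) (m n k : nat) (f : Omega m X) (s : 'I_m -> 'I_k)
    (a : k.-tuple X) :
  odot n f [tuple tnth [tuple (fun=> tnth a j) : Omega n X | j < k] (s i)
           | i < m]
  = fun=> f [tuple tnth a (s i) | i < m].
Proof.
apply: functional_extensionality => x; rewrite odot_eval; congr f.
by apply: eq_from_tnth => i; rewrite !tnth_mktuple.
Qed.

Lemma is_pi_conjugate_odot (X : Type) (m n : nat) (pi : 'S_m.+1)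
    (f g : Omega m X) :
  is_pi_conjugate pi f g <-> is_pi_conjugate pi (odot n f) (odot n g).
Proof.
split=> [fg h | FG a].
  have fgx x := fg [tuple tnth h j x | j < m.+1].
  (* Evaluated at [x], both equations of functions become those of [fgx x]. *)
  by split=> e; apply: functional_extensionality => x;
    move: (fgx x) (congr1 (@^~ x) e);
    rewrite /= !odot_eval !(tnth_mktuple _ (pi _)) !(tnth_mktuple _ ord_max);
    case.
have const_inj (u v : X) : (fun=> u) = (fun=> v) :> Omega n X <-> u = v.
  split=> [e | -> //].
  (* [X] may be empty in general, but [a] has m+1 > 0 entries; repeating its last one gives a point
     of X^n. *)
  exact: (congr1 (@^~ (nseq_tuple n (tnth a ord_max))) e).
have := FG [tuple (fun=> tnth a j) : Omega n X | j < m.+1].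
rewrite (odot_const _ _ _ _ g (fun i => pi (widen_ord (leqnSn m) i))).
rewrite (odot_const _ _ _ _ f (widen_ord (leqnSn m))).
by rewrite !tnth_mktuple; case=> gf fg; split=> /const_inj; [move/gf | move/fg];
  move/const_inj.
Qed.

Theorem lemma3p8 (X : Type) (m n : nat) (hm : 2 <= m) (hn : 2 <= n)
    (f g : Omega m X) :
  (op_conjugate f g <-> op_conjugate (odot n f) (odot n g))
  /\ (forall pi : 'S_m.+1,
        is_pi_conjugate pi f g
        <-> is_pi_conjugate pi (odot n f) (odot n g)).
Proof.
have conjP pi := is_pi_conjugate_odot X m n pi f g.
by split=> //; split=> -[pi /conjP fg]; exists pi.
Qed.
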